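(* There exists a function $\varepsilon:\mathbb{Z}_{\ge 1}\to\mathbb{R}$ with $\lim_{k\to\infty}\varepsilon(k)=0$ such that for every integer $k\ge 1$ and every $n$, every outer $k$-planar graph on $n$ vertices has at most $(\sqrt{2}+\varepsilon(k))\sqrt{k}\,n+n$ edges.
   Context: A convex geometric graph is a drawing of a finite simple graph in the plane whose vertex set is a set of points in convex position (no three collinear) and whose edges are drawn as straight-line segments between their endpoints. Two edges cross if they share a point in their relative interiors. The drawing is $k$-plane if each edge crosses at most $k$ other edges. A graph is outer $k$-planar if it admits a convex geometric $k$-plane drawing. *)

(* Defs.v *)
(* MathComp / MathComp-Analysis *)
From mathcomp Require Import all_boot all_order all_algebra.
From mathcomp Require Import all_classical all_reals all_analysis.

Set Implicit Arguments.
Unset Strict Implicit.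
Unset Printing Implicit Defensive.

Import Order.TTheory GRing.Theory Num.Theory.
Import numFieldNormedType.Exports.

Local Open Scope ring_scope.

Definition edge_set (V : finType) (adj : rel V) : {set {set V}} :=
  [set [set uv.1; uv.2] | uv : V * V & adj uv.1 uv.2]%SET.

Section ConvexGeometricDrawing.
Variable R : realType.

Local Open Scope classical_set_scope.

Definition convex_hull (A : set 'rV[R]_2) : set 'rV[R]_2 :=
  smallest (@convex_set R 'rV[R]_2) A.

Definition collinear (a b c : 'rV[R]_2) : Prop :=
  exists q d : 'rV[R]_2, exists r s t : R,
    [/\ a = q + r *: d, b = q + s *: d & c = q + t *: d].

Definition no_three_collinear (S : set 'rV[R]_2) : Prop :=
  forall a b c, S a -> S b -> S c ->
    a != b -> b != c -> a != c -> ~ collinear a b c.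

(* The first clause already excludes three collinear points; the second one
   makes this explicit. *)
Definition convex_position (S : set 'rV[R]_2) : Prop :=
  (forall x, S x -> ~ convex_hull (S `\ x) x) /\ no_three_collinear S.

Definition open_segment (a b : 'rV[R]_2) : set 'rV[R]_2 :=
  [set x | exists2 t : R, 0 < t < 1 & x = (1 - t) *: a + t *: b].

Variable V : finType.

(* For an edge f = {u, v}, the relative interior of its segment; the result
   does not depend on the order of u and v. *)
Definition edge_interior (p : V -> 'rV[R]_2) (f : {set V}) : set 'rV[R]_2 :=
  [set x | exists u v : V,
     [/\ u != v, f = [set u; v]%SET & open_segment (p u) (p v) x]].

Definition crosses (p : V -> 'rV[R]_2) (f g : {set V}) : Prop :=
  edge_interior p f `&` edge_interior p g !=set0.

Definition convex_geometric (p : V -> 'rV[R]_2) : Prop :=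
  injective p /\ convex_position (range p).

Definition k_plane (k : nat) (adj : rel V) (p : V -> 'rV[R]_2) : Prop :=
  forall f, f \in edge_set adj ->
    (#|[set g in edge_set adj | (g != f) && `[< crosses p f g >]]%SET| <= k)%N.

Definition outer_k_planar (k : nat) (adj : rel V) : Prop :=
  exists p : V -> 'rV[R]_2, convex_geometric p /\ k_plane k adj p.

End ConvexGeometricDrawing.

(* Main.v *)
Require Import Defs.
From mathcomp Require Import all_boot all_order all_algebra.
From mathcomp Require Import all_classical all_reals all_analysis.
From mathcomp Require Import zify ring lra.
Import Order.TTheory GRing.Theory Num.Theory.
Import numFieldNormedType.Exports.

(** Let t be about sqrt (2 k) + 4, so that t ^ 2 - 3 t >= 2 k.  The number of
    edges is at most t n, by induction on the number of vertices.

    An edge u v splits the remaining vertices into two arcs.  If every arc cut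
    off by an edge has fewer than t vertices, then n <= 2 t and even the complete
    graph has at most t n edges.  Otherwise take, among the arcs with at least t
    vertices, a smallest one: A, cut off by u v, with L vertices.  Deleting A
    destroys two kinds of edges.  Those leaving the closed arc cross u v, so there
    are at most k.  Those inside the closed arc, u v itself excepted, cut off a
    smaller arc, which has fewer than t vertices by the choice of A.  Numbering
    the closed arc 0, ..., L + 1, these are pairs of positions at distance at
    most t, and there are t L + 2 t - t (t + 1) / 2 such pairs.  The choice of t
    makes the total loss at most t L, which is what the induction allows for L
    deleted vertices.  Because short chords number only linearly
    many in L, this works however large the smallest long arc turns out to be.

    Geometry enters only through the cyclic order of the vertices.  The relation
    saying that a, b, c are in counterclockwise position satisfies the axioms of
    a cyclic order: transitivity holds because its failure would put a point
    inside the triangle of three others (ccw_trans).  Chords with interleaved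
    endpoints do cross (ccw_crosses).  The counting argument (card_induced_le) is
    then carried out for an arbitrary cyclic order.

    Since t <= sqrt 2 * sqrt k + 4, the error term 4 / sqrt k works. *)

(** * Pairs of positions at bounded distance *)

Lemma sum_min_ord (t N : nat) : t <= N ->
  2 * (\sum_(j < N) minn j t) + (t * t + t) = 2 * (t * N).
Proof.
have sum_ord n : 2 * (\sum_(j < n) (j : nat)) + n = n * n.
  elim: n => [|n IHn]; rewrite ?big_ord0 // big_ord_recr /=.
  by move: (\sum_(j < n) _) IHn => s; nia.
move=> /subnK <-; elim: (N - t) => [|d IHd].
  rewrite add0n (eq_bigr (fun j : 'I_t => (j : nat))); first by rewrite addnCA sum_ord mul2n addnn.
  by move=> j _; apply/minn_idPl/ltnW.
rewrite addSn big_ord_recr /= (minn_idPr _) ?leq_addl //.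
by move: (\sum_(j < d + t) _) IHd => s; nia.
Qed.

(** A position j is the right end of at most [minn j t] such pairs, one for
    each admissible distance. *)
Lemma card_short_pairs (t N : nat) : t <= N ->
  2 * #|[set ij : 'I_N * 'I_N | ij.1 < ij.2 <= ij.1 + t]| + (t * t + t)
    <= 2 * (t * N).
Proof.
move=> tN; rewrite -(sum_min_ord t N tN) leq_add2r leq_mul2l /=.
(* Summing over the right end first. *)
pose sw (ij : 'I_N * 'I_N) := (ij.2, ij.1).
rewrite cardsE -sum1_card (reindex sw) /=; last by exists sw => -[].
under eq_bigl do rewrite unfold_in /=.
rewrite -(pair_big_dep xpredT (fun j i : 'I_N => i < j <= i + t) (fun _ _ => 1)) /=.
apply: leq_sum => j _; rewrite sum1_card.
rewrite cardE -(size_map (fun i : 'I_N => j - i)) -(size_iota 1 (minn j t)).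
apply: uniq_leq_size => [|x /mapP[i]].
  rewrite map_inj_in_uniq ?enum_uniq // => i i'; rewrite !mem_enum !unfold_in.
  by move=> ? ? ?; apply/val_inj => /=; lia.
by rewrite mem_enum unfold_in mem_iota => ? ->; lia.
Qed.

(** * Cyclic orders and their arcs *)

Section CyclicOrder.
Variables (V : finType) (C : V -> V -> V -> bool).
Hypothesis C_rot : forall a b c, C a b c -> C b c a.
Hypothesis C_asym : forall a b c, C a b c -> ~~ C a c b.
Hypothesis C_total : forall a b c, a != b -> b != c -> a != c -> C a b c || C a c b.
Hypothesis C_trans : forall a b c d, C a b c -> C a c d -> C a b d.

Lemma C_neq a b c : C a b c -> [&& a != b, b != c & a != c].
Proof.
move=> abc; apply/and3P; split; apply/eqP => e; subst.
- by have := C_asym _ _ _ abc; rewrite (C_rot _ _ _ abc).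
- by have := C_asym _ _ _ abc; rewrite abc.
- by have := C_asym _ _ _ (C_rot _ _ _ abc); rewrite (C_rot _ _ _ abc).
Qed.

(** Cutting the cyclic order at [u] gives a strict linear order with least
    element [u]; it is what allows vertices of an arc to be numbered. *)
Definition precedes (u x y : V) := C u x y || ((x == u) && (y != u)).

Lemma precedes_asym u x y : precedes u x y -> ~~ precedes u y x.
Proof.
move=> /orP[xy|/andP[/eqP -> yu]]; rewrite /precedes negb_or.
  have /and3P[_ _ uy] := C_neq _ _ _ xy.
  by rewrite C_asym //= eq_sym (negPf uy).
rewrite (negPf yu) andbT; apply/negP => /C_neq.
by rewrite eqxx !andbF.
Qed.

Lemma precedes_irrefl u x : precedes u x x = false.
Proof. by apply/negP => xx; have := precedes_asym _ _ _ xx; rewrite xx. Qed.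

Lemma precedes_total u x y : x != y -> precedes u x y || precedes u y x.
Proof.
move=> xy; rewrite /precedes; have [e|xu] /= := eqVneq x u; first by rewrite -e eq_sym xy !orbT.
have [e|yu] /= := eqVneq y u; first by rewrite !orbT.
by rewrite !orbF; apply: C_total; rewrite // eq_sym.
Qed.

Lemma precedes_trans u x y z : precedes u x y -> precedes u y z -> precedes u x z.
Proof.
move=> /orP[xy|/andP[/eqP -> yu]] /orP[yz|/andP[/eqP e zu]].
- by apply/orP; left; apply: C_trans xy yz.
- by subst y; have := C_neq _ _ _ xy; rewrite eqxx !andbF.
- by have /and3P[_ _ uz] := C_neq _ _ _ yz; rewrite /precedes eqxx eq_sym uz orbT.
- by rewrite e eqxx in yu.
Qed.

Lemma precedes_between u x y z : precedes u x y -> precedes u y z -> C x y z.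
Proof.
move=> /orP[xy|/andP[/eqP -> yu]] /orP[yz|/andP[/eqP e zu]] //.
- by do 2!apply: C_rot; apply: C_trans (C_rot _ _ _ yz) _; do 2!apply: C_rot.
- by subst y; have := C_neq _ _ _ xy; rewrite eqxx !andbF.
- by rewrite e eqxx in yu.
Qed.

Lemma between_precedes u x y z : precedes u x z -> C x y z -> C u y z.
Proof.
move=> /orP[xz|/andP[/eqP -> zu]] // /C_rot /C_rot zxy; apply: C_rot.
by apply: C_trans zxy; do 2!apply: C_rot.
Qed.

Definition arc (S : {set V}) u v := [set w in S | C u w v].

Section ClosedArc.
Variables (S : {set V}) (u v : V).
Hypotheses (uS : u \in S) (vS : v \in S) (uv : u != v).

Definition closed_arc := u |: (v |: arc S u v).

Definition position x := #|[set w in closed_arc | precedes u w x]|.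

Lemma closed_arcE w : (w \in closed_arc) = (w \in S) && ((w == v) || precedes u w v).
Proof.
rewrite !inE /precedes [v == u]eq_sym uv andbT.
have [->|wu] /= := eqVneq w u; first by rewrite uS !orbT.
have [->|wv] /= := eqVneq w v; first by rewrite vS.
by rewrite orbF.
Qed.

Lemma card_closed_arc : #|closed_arc| = #|arc S u v|.+2.
Proof.
rewrite !cardsU1 !inE (negPf uv) /=.
have /negPf -> : ~~ C u u v by apply/negP => /C_neq; rewrite eqxx.
have /negPf -> : ~~ C u v v by apply/negP => /C_neq; rewrite eqxx !andbF.
by rewrite !andbF.
Qed.

Lemma position_lt x y : x \in closed_arc -> precedes u x y -> position x < position y.
Proof.
move=> xD xy; apply/proper_card/fintype.properP; split.
  by apply/fintype.subsetP=> w; rewrite !inE => /andP[-> /precedes_trans ->].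
by exists x; rewrite [_ \in finset _]inE xD ?xy ?precedes_irrefl.
Qed.

Lemma position_inj : {in closed_arc &, injective position}.
Proof.
move=> x y xD yD exy; apply/eqP/negPn/negP => /(precedes_total u) /orP[] /position_lt.
  by move/(_ xD); rewrite exy ltnn.
by move/(_ yD); rewrite exy ltnn.
Qed.

Lemma position_bound x : x \in closed_arc -> position x < #|arc S u v|.+2.
Proof.
move=> xD; rewrite -card_closed_arc; apply/proper_card/fintype.properP; split.
  by apply/fintype.subsetP=> w; rewrite inE => /andP[].
by exists x; rewrite // [_ \in finset _]inE precedes_irrefl andbF.
Qed.

(** The vertices before [y] are those before [x], then [x], then those of the
    arc from [x] to [y]: chords cutting off short arcs join close positions. *)
Lemma position_gap x y : x \in closed_arc ->
  position y <= position x + #|arc S x y|.+1.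
Proof.
move=> xD; pose B := [set w in closed_arc | precedes u w x].
have : [set w in closed_arc | precedes u w y] \subset B :|: (x |: arc S x y).
  apply/fintype.subsetP => w; rewrite finset.in_set => /andP[wD wy].
  rewrite finset.in_setU in_setU1 finset.in_set wD /=.
  have [->|wx] /= := eqVneq w x; first by rewrite orbT.
  have /orP[->//|xw] := precedes_total u _ _ wx.
  have wS : w \in S by move: wD; rewrite closed_arcE => /andP[].
  by rewrite inE wS (precedes_between _ _ _ _ xw wy) orbT.
move/subset_leq_card => h; apply: leq_trans h _.
apply: leq_trans (leq_card_setU _ _) _; rewrite leq_add2l cardsU1.
by case: (_ \notin _); rewrite ?leqnSn.
Qed.

(** Nested arcs: this is where minimality of the chosen arc will apply.  The
    endpoint [z] rules out the chord [u v] itself, and witnesses that the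
    inclusion of arcs is strict. *)
Lemma arc_proper x y z : y \in closed_arc -> precedes u x y ->
  z \in [set x; y] -> z \in arc S u v -> #|arc S x y| < #|arc S u v|.
Proof.
move=> yD xy zxy zA; apply/proper_card/fintype.properP; split; last first.
  exists z => //; rewrite inE; apply/negP => /andP[_ /C_neq].
  by move: zxy; rewrite !inE => /orP[] /eqP ->; rewrite eqxx ?andbF.
apply/fintype.subsetP => w; rewrite !inE => /andP[-> /(between_precedes _ _ _ _ xy) uwy] /=.
move: yD; rewrite closed_arcE => /andP[_ /orP[/eqP <- //|/orP[]]].
  exact: C_trans.
by have /and3P[_ _ uy] := C_neq _ _ _ uwy; rewrite eq_sym (negPf uy).
Qed.

End ClosedArc.

(** * The counting argument *)

Variables (E : {set {set V}}) (t : nat).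
Hypothesis t_gt0 : 0 < t.
Hypothesis edge_pair : forall f, f \in E -> exists x y, x != y /\ f = [set x; y].

Definition induced (S : {set V}) := [set f in E | f \subset S].

(** Edges inside the closed arc that meet the arc are mapped injectively to
    pairs of positions at distance at most [t]. *)
Lemma card_inside_arc (S : {set V}) u v :
  u \in S -> v \in S -> u != v -> t <= #|arc S u v| ->
  (forall x y, [set x; y] \in induced S -> #|arc S x y| < #|arc S u v| -> #|arc S x y| < t) ->
  2 * #|[set f in induced (closed_arc S u v) | ~~ [disjoint f & arc S u v]]| + (t * t + t)
    <= 2 * (t * #|arc S u v|.+2).
Proof.
move=> uS vS uv tA minA.
set D := closed_arc S u v; set A := arc S u v; set F := [set f in _ | _].
pose pos := position S u v; pose N := #|A|.+1.
have DS : D \subset S by apply/fintype.subsetP => w; rewrite closed_arcE // => /andP[].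
pose P := [set xy : V * V | [&& xy.1 \in D, xy.2 \in D & pos xy.1 < pos xy.2 <= pos xy.1 + t]].
have memP x y : ((x, y) \in P) = [&& x \in D, y \in D & pos x < pos y <= pos x + t].
  by rewrite finset.in_set.
apply: leq_trans (card_short_pairs t N.+1 _); last exact: leqW (leqW tA).
rewrite leq_add2r leq_mul2l /=; apply: (@leq_trans #|P|).
  apply: leq_trans (leq_imset_card (fun xy : V * V => [set xy.1; xy.2]) P).
  apply/subset_leq_card/fintype.subsetP => f; rewrite inE => /andP[fD].
  rewrite -finset.setI_eq0 => /finset.set0Pn[z /finset.setIP[zf zA]].
  move: fD; rewrite inE => /andP[fE fD].
  have [x [y [xy ef]]] := edge_pair _ fE.
  wlog xyu : x y xy ef / precedes u x y.
    move=> h; have /orP[xyu|yxu] := precedes_total u _ _ xy; first exact: h ef xyu.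
    by apply: (h y x); rewrite // 1?eq_sym // finset.setUC.
  have xD : x \in D by apply: (fintype.subsetP fD); rewrite ef !inE eqxx.
  have yD : y \in D by apply: (fintype.subsetP fD); rewrite ef !inE eqxx orbT.
  apply/imsetP; exists (x, y) => //; rewrite memP xD yD (position_lt _ _ _ _ _ xD xyu) /=.
  apply: leq_trans (position_gap _ _ _ uS vS uv _ _ xD) _; rewrite leq_add2l.
  apply: minA; first by rewrite -ef inE fE (fintype.subset_trans fD).
  by apply: (arc_proper _ _ _ uS vS uv _ _ z); rewrite -?ef.
pose g (xy : V * V) : 'I_N.+1 * 'I_N.+1 := (inord (pos xy.1), inord (pos xy.2)).
have posN x : x \in D -> (inord (pos x) : 'I_N.+1) = pos x :> nat.
  by move=> xD; rewrite inordK //; apply: position_bound.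
rewrite -(card_in_imset (f := g) (D := P)) => [|[x y] [x' y']].
  apply/subset_leq_card/fintype.subsetP => _ /imsetP[[x y] xyP ->].
  by move: xyP; rewrite memP => /and3P[xD yD]; rewrite finset.in_set /= !posN.
rewrite !memP => /and3P[xD yD _] /and3P[xD' yD' _] [/(congr1 val) /= ex /(congr1 val) /= ey].
have posI := position_inj S u v; rewrite !posN // in ex ey.
by congr (_, _); apply: posI.
Qed.

Variables (k : nat) (cr : rel {set V}).
Hypothesis cr_interleaved : forall u v x y, C u x v -> C u v y -> cr [set u; v] [set x; y].
Hypothesis cr_le : forall f, f \in E -> #|[set g in E | (g != f) && cr f g]| <= k.
Hypothesis t_large : 2 * k + 3 * t <= t * t.

(** An edge lost with the arc either stays in the closed arc or leaves it, and
    in the latter case its endpoints are separated by [u] and [v]. *)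
Lemma induced_remove_arc (S : {set V}) u v :
  u \in S -> v \in S -> u != v -> [set u; v] \in E ->
  #|induced S| <= #|induced (S :\: arc S u v)|
    + #|[set f in induced (closed_arc S u v) | ~~ [disjoint f & arc S u v]]| + k.
Proof.
move=> uS vS uv eE.
apply: leq_trans (leq_add (leqnn _) (cr_le _ eE)).
apply: leq_trans (leq_add (leq_card_setU _ _) (leqnn _)).
apply: leq_trans (leq_card_setU _ _); apply/subset_leq_card/fintype.subsetP => f.
rewrite inE => /andP[fE fS]; rewrite [_ \in _ :|: _]inE [_ \in _ :|: _]inE.
rewrite ![_ \in finset _]inE fE /= finset.subsetD fS /=.
case: (boolP [disjoint f & arc S u v]) => //= fA.
rewrite andbT; apply/orP; move: fA; rewrite -finset.setI_eq0 => /finset.set0Pn[z /finset.setIP[zf zA]].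
have [y [yS ef]] : exists y, y \in S /\ f = [set z; y].
  have [x [y [_ ef]]] := edge_pair _ fE; move: zf fS; rewrite {}ef => zf /fintype.subsetP fS.
  move: zf; rewrite !inE => /orP[] /eqP ->; [exists y | exists x]; split => //.
  - by apply: fS; rewrite !inE eqxx orbT.
  - by apply: fS; rewrite !inE eqxx.
  - by rewrite finset.setUC.
have zD : z \in closed_arc S u v by rewrite !in_setU1 zA !orbT.
have [yD|yD] := boolP (y \in closed_arc S u v); [left | right].
  by rewrite ef finset.subUset !finset.sub1set zD.
move: yD; rewrite !in_setU1 !negb_or inE yS /= => /and3P[yu yv nuyv].
move: zA; rewrite inE => /andP[_ uzv]; have /and3P[uz zv _] := C_neq _ _ _ uzv.
apply/andP; split.
  apply: contraL zf => /eqP ->; rewrite !inE negb_or zv andbT eq_sym //.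
rewrite ef; apply: cr_interleaved => //.
have := C_total u y v; rewrite (negPf nuyv) /=; apply => //; by rewrite eq_sym.
Qed.

(** The stated condition on [t] is exactly what makes the loss
    [k + t L + 2 t - t (t + 1) / 2] at most [t L]. *)
Theorem card_induced_le (S : {set V}) : #|induced S| <= t * #|S|.
Proof.
have [n] := ubnP #|S|; elim: n S => // n IHn S ltSn.
pose long (q : V * V) := ([set q.1; q.2] \in induced S) && (t <= #|arc S q.1 q.2|).
have edge x y : [set x; y] \in induced S -> [/\ [set x; y] \in E, x \in S, y \in S & x != y].
  rewrite inE => /andP[eE /fintype.subsetP eS]; split=> //.
  - by apply: eS; rewrite !inE eqxx.
  - by apply: eS; rewrite !inE eqxx orbT.
  have [a [b [ab eab]]] := edge_pair _ eE; have := cards2 a b; rewrite -eab cards2 ab.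
  by case: (x != y).
have [q0 q0P|nolong] := pickP long.
  case: (arg_minnP (fun q : V * V => #|arc S q.1 q.2|) q0P) => -[u v] /= /andP[/= uvE tA] minA.
  have [eE uS vS uv] := edge _ _ uvE.
  have step := induced_remove_arc _ _ _ uS vS uv eE.
  set F := #|[set f in induced (closed_arc S u v) | _]| in step.
  have inside : 2 * F + (t * t + t) <= 2 * (t * #|arc S u v|.+2).
    apply: card_inside_arc => // x y xyE lt_xy; rewrite ltnNge; apply/negP => t_xy.
    by have := minA (x, y); rewrite /long /= xyE t_xy leqNgt lt_xy => /(_ isT).
  have AS : arc S u v \subset S by apply/fintype.subsetP => w; rewrite inE => /andP[].
  have cS : #|S :\: arc S u v| + #|arc S u v| = #|S|.
    by rewrite cardsD (finset.setIidPr AS) subnK ?subset_leq_card.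
  have IH : #|induced (S :\: arc S u v)| <= t * #|S :\: arc S u v|.
    apply: IHn; rewrite -ltnS; apply: leq_trans ltSn; rewrite ltnS -cS.
    by rewrite -[ltnLHS]addn0 ltn_add2l (leq_trans t_gt0).
  apply: leq_trans step _; rewrite -cS; move: F inside IH t_large {minA AS cS} tA.
  move: #|arc S u v| #|S :\: _| #|induced _| => a b c F; nia.
(* No long arc: the two arcs of any edge show that S has at most 2 t vertices. *)
have [->|[f fS]] := finset.set_0Vmem (induced S); first by rewrite cards0.
have := fS; rewrite inE => /andP[fE _].
have [u [v [_ ef]]] := edge_pair _ fE; rewrite {}ef in fS.
have [eE uS vS uv] := edge _ _ fS.
have short x y : [set x; y] \in induced S -> #|arc S x y| < t.
  by move=> xy; have := nolong (x, y); rewrite /long /= xy /= leqNgt => /negbFE.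
have cS : #|S| <= 2 * t.
  have : S \subset [set u; v] :|: (arc S u v :|: arc S v u).
    apply/fintype.subsetP => w wS; rewrite !inE wS /=.
    have [//|wu] := eqVneq w u; have [//|wv] /= := eqVneq w v.
    have := C_total u w v; rewrite eq_sym wu wv uv => /(_ isT isT isT) /orP[-> //|/C_rot ->].
    by rewrite orbT.
  move/subset_leq_card => h; apply: leq_trans h _.
  apply: leq_trans (leq_card_setU _ _) _; rewrite cards2 uv.
  apply: leq_trans (leq_add (leqnn _) (leq_card_setU _ _)) _.
  have := short _ _ fS; rewrite finset.setUC in fS; have := short _ _ fS; lia.
have : induced S \subset [set f : {set V} | f \subset S & #|f| == 2].
  apply/fintype.subsetP => g; rewrite !inE => /andP[gE ->].
  by have [a [b [ab ->]]] := edge_pair _ gE; rewrite cards2 ab.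
move/subset_leq_card; rewrite cards_draws => h; apply: leq_trans h _.
rewrite bin2 -leq_double; apply: leq_trans (_ : #|S| * #|S|.-1 <= _).
  by rewrite -[leqRHS]odd_double_half leq_addl.
by rewrite -muln2; nia.
Qed.
End CyclicOrder.

Local Open Scope classical_set_scope.
Local Open Scope ring_scope.

(** * Orientation of triples of points *)

Section Orientation.
Variable R : realType.
Implicit Types a b c d x : 'rV[R]_2.

(** Twice the signed area of the triangle [a b c]. *)
Definition orient a b c : R :=
  (b 0 0 - a 0 0) * (c 0 1 - a 0 1) - (b 0 1 - a 0 1) * (c 0 0 - a 0 0).

Lemma orient_rot a b c : orient b c a = orient a b c.
Proof. by rewrite /orient; ring. Qed.

Lemma orient_swap a b c : orient a c b = - orient a b c.
Proof. by rewrite /orient; ring. Qed.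

Lemma orient_refl a b : orient a a b = 0.
Proof. by rewrite /orient; ring. Qed.

Lemma eq_rV2 a b : a 0 0 = b 0 0 -> a 0 1 = b 0 1 -> a = b.
Proof.
move=> e0 e1; apply/rowP => -[[|[|//]] i].
  by rewrite (_ : Ordinal i = 0) //; apply/val_inj.
by rewrite (_ : Ordinal i = 1) //; apply/val_inj.
Qed.

Lemma orient_eq0_collinear a b c : orient a b c = 0 -> a != b -> collinear a b c.
Proof.
move=> o0 ab; exists a, (b - a).
have [e0|n0] := eqVneq (b 0 0) (a 0 0); last first.
  have := n0; rewrite -subr_eq0 => n0'.
  exists 0, 1, ((c 0 0 - a 0 0) / (b 0 0 - a 0 0)); split.
  - by rewrite scale0r addr0.
  - by rewrite scale1r addrC subrK.
  apply: eq_rV2; rewrite !mxE; first by field.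
  have h : c 0 1 - a 0 1 = (b 0 1 - a 0 1) * (c 0 0 - a 0 0) / (b 0 0 - a 0 0).
    by apply/(canRL (mulfK n0')); move: o0; rewrite /orient; lra.
  by rewrite -[LHS](subrK (a 0 1)) h; field.
have n1 : b 0 1 - a 0 1 != 0.
  by rewrite subr_eq0; apply: contra_neq ab => e1; apply: eq_rV2.
exists 0, 1, ((c 0 1 - a 0 1) / (b 0 1 - a 0 1)); split.
- by rewrite scale0r addr0.
- by rewrite scale1r addrC subrK.
apply: eq_rV2; rewrite !mxE; last by field.
have : (b 0 1 - a 0 1) * (c 0 0 - a 0 0) = 0.
  by move: o0; rewrite /orient e0; lra.
by move/eqP; rewrite mulf_eq0 (negPf n1) e0 /= => /eqP; lra.
Qed.

(** The three orientations are, up to normalisation, the barycentric coordinates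
    of [x] with respect to [c], [a], [b]; the convex combination is formed in
    two binary steps. *)
Lemma convex_hull_triangle (A : set 'rV[R]_2) a b c x : A a -> A b -> A c ->
  0 < orient x a b -> 0 < orient x b c -> 0 < orient x c a ->
  convex_hull A x.
Proof.
move=> Aa Ab Ac ab bc ca B [cB AB].
have s0 : 0 < orient x b c + orient x c a by lra.
have S0 : 0 < orient x a b + (orient x b c + orient x c a) by lra.
have l0 : 0 <= orient x a b / (orient x a b + (orient x b c + orient x c a)).
  by rewrite divr_ge0 // ltW.
have l1 : orient x a b / (orient x a b + (orient x b c + orient x c a)) <= 1.
  by rewrite ler_pdivrMr //; lra.
have m0 : 0 <= orient x b c / (orient x b c + orient x c a) by rewrite divr_ge0 // ltW.
have m1 : orient x b c / (orient x b c + orient x c a) <= 1 by rewrite ler_pdivrMr //; lra.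
have Bab := cB _ _ (Itv01 m0 m1) (mem_set (AB _ Aa)) (mem_set (AB _ Ab)).
have := cB _ _ (Itv01 l0 l1) (mem_set (AB _ Ac)) Bab.
rewrite inE; congr (B _); rewrite /conv /= /unstable.onem.
by apply: eq_rV2; rewrite !mxE /orient; field;
  (apply/andP; split; [exact: lt0r_neq0 s0|exact: lt0r_neq0 S0]).
Qed.

(** The areas satisfy [bcd * a - acd * b + abd * c - abc * d = 0], with
    [bcd + abd = acd + abc]; separating signs exhibits one point as a
    combination of [a], [c] and of [b], [d]. *)
Lemma open_segments_meet a b c d :
  0 < orient a b c -> 0 < orient a c d -> 0 < orient a b d -> 0 < orient b c d ->
  open_segment a c `&` open_segment b d !=set0.
Proof.
move=> abc acd abd bcd.
have s0 : 0 < orient b c d + orient a b d by lra.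
have r0 : 0 < orient a c d + orient a b c by lra.
exists ((1 - orient a b d / (orient b c d + orient a b d)) *: a +
        (orient a b d / (orient b c d + orient a b d)) *: c); split.
  exists (orient a b d / (orient b c d + orient a b d)) => //.
  by rewrite divr_gt0 //= ltr_pdivrMr //; lra.
exists (orient a b c / (orient a c d + orient a b c)).
  by rewrite divr_gt0 //= ltr_pdivrMr //; lra.
by apply: eq_rV2; rewrite !mxE /orient; field; exact: lt0r_neq0 r0.
Qed.

End Orientation.

(** * The cyclic order of points in convex position *)

Section CyclicOrderOfDrawing.
Variables (R : realType) (V : finType) (p : V -> 'rV[R]_2).
Hypothesis p_convex : convex_geometric p.

Definition ccw (a b c : V) : bool := 0 < orient R (p a) (p b) (p c).

Lemma ccw_rot a b c : ccw a b c -> ccw b c a.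
Proof. by rewrite /ccw (orient_rot _ (p a)). Qed.

Lemma ccw_asym a b c : ccw a b c -> ~~ ccw a c b.
Proof. by rewrite /ccw => abc; rewrite orient_swap oppr_gt0 -leNgt ltW. Qed.

Lemma ccw_total a b c : a != b -> b != c -> a != c -> ccw a b c || ccw a c b.
Proof.
have [p_inj [_ p_gen]] := p_convex; move=> ab bc ac.
have : orient R (p a) (p b) (p c) != 0.
  apply/eqP => o0; apply: (p_gen (p a) (p b) (p c)); rewrite ?inj_eq //; try by eexists.
  by apply: orient_eq0_collinear; rewrite ?inj_eq.
rewrite neq_lt /ccw (orient_swap _ (p a) (p b)) => /orP[] o0; last by rewrite o0.
by rewrite orbC oppr_gt0 o0.
Qed.

Lemma ccw_neq a b c : ccw a b c -> a != b.
Proof. by rewrite /ccw; apply: contraTneq => ->; rewrite orient_refl ltxx. Qed.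

(** If instead [d] were before [b] around [a], the three triangles [abc], [acd],
    [adb] would be positively oriented and [a] would lie inside [bcd]. *)
Lemma ccw_trans a b c d : ccw a b c -> ccw a c d -> ccw a b d.
Proof.
have [p_inj [p_hull _]] := p_convex; move=> abc acd.
have ab := ccw_neq _ _ _ abc; have ac := ccw_neq _ _ _ acd.
have ad : a != d by rewrite eq_sym; apply: (ccw_neq d a c); do 2!apply: ccw_rot.
have [e|bd] := eqVneq b d; first by have := ccw_asym _ _ _ abc; rewrite e acd.
have /orP[//|adb] := ccw_total _ _ _ ab bd ad.
have mem x : a != x -> (range p `\ p a) (p x).
  by move=> ax; split; [exists x | apply/eqP; rewrite inj_eq // eq_sym].
case: (p_hull (p a)); first by exists a.
by apply: (convex_hull_triangle _ _ (p b) (p c) (p d)); try exact: mem.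
Qed.

Lemma ccw_crosses u v x y : ccw u x v -> ccw u v y -> crosses p [set u; v]%SET [set x; y]%SET.
Proof.
move=> uxv uvy; have uxy := ccw_trans _ _ _ _ uxv uvy.
have xvy : ccw x v y.
  do 2!apply: ccw_rot; apply: (ccw_trans _ _ u); first exact: ccw_rot.
  by do 2!apply: ccw_rot.
have [z [zuv zxy]] := open_segments_meet _ _ _ _ _ uxv uvy uxy xvy.
exists z; split; [exists u, v|exists x, y]; split => //.
  exact: ccw_neq uvy.
by apply: (ccw_neq x y u); apply: ccw_rot.
Qed.

End CyclicOrderOfDrawing.

(** * The asymptotic bound *)

Lemma cvg_div_sqrt (R : realType) (c : R) :
  c / Num.sqrt k%:R @[k --> \oo] --> (0 : R).
Proof.
apply/cvgrPdist_lt => e e0; near=> k.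
have k0 : (0 : R) < k%:R by near: k; exact: nbhs_infty_gtr.
have sk0 : 0 < Num.sqrt k%:R :> R by rewrite sqrtr_gt0.
rewrite sub0r normrN normrM normfV (gtr0_norm sk0) ltr_pdivrMr // -ltr_pdivrMl //.
rewrite -[ltLHS]ger0_norm ?mulr_ge0 ?invr_ge0 ?(ltW e0) //.
rewrite -sqrtr_sqr ltr_sqrt //; near: k; exact: nbhs_infty_gtr.
Unshelve. all: by end_near. Qed.

Theorem corollary11 (R : realType) :
  exists eps : nat -> R,
    (eps k @[k --> \oo] --> (0 : R)) /\
    forall (k n : nat) (V : finType) (adj : rel V),
      (1 <= k)%N -> #|V| = n ->
      symmetric adj -> irreflexive adj -> outer_k_planar R k adj ->
      (#|edge_set adj|)%:R <=
        (Num.sqrt 2 + eps k) * Num.sqrt k%:R * n%:R + n%:R :> R.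
Proof.
exists (fun k => 4 / Num.sqrt k%:R); split; first exact: cvg_div_sqrt.
move=> k n V adj k1 Vn _ adj_irr [p [p_convex p_plane]].
(* m > sqrt (2 k), and t = m + 3 gives t ^ 2 - 3 t = m ^ 2 + 3 m >= 2 k. *)
set m := (Num.truncn (Num.sqrt (2 * k%:R : R))).+1; pose t := (m + 3)%N.
have sk : Num.sqrt (2 * k%:R) < m%:R :> R by exact: truncnS_gt.
have mt : m%:R <= Num.sqrt (2 * k%:R) + 1 :> R.
  by rewrite -[m]addn1 natrD lerD2r truncn_le // sqrtr_ge0.
have km : (2 * k <= m * m)%N.
  rewrite -(ler_nat R) !natrM -[leLHS]sqr_sqrtr ?mulr_ge0 // expr2.
  by rewrite ler_pM ?sqrtr_ge0 // ltW.
have edge_pair f : f \in edge_set adj -> exists x y, x != y /\ f = [set x; y]%SET.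
  case/imsetP=> -[x y]; rewrite inE /= => xy ->; exists x, y; split => //.
  by apply: contraTneq xy => ->; rewrite adj_irr.
have bound : (#|edge_set adj| <= t * #|V|)%N.
  have := @card_induced_le V (ccw R V p) (ccw_rot R V p) (ccw_asym R V p)
    (ccw_total R V p p_convex) (ccw_trans R V p p_convex)
    (edge_set adj) t _ edge_pair k (fun f g => `[< crosses p f g >]) _ p_plane _ [set: V]%SET.
  rewrite cardsT (_ : induced _ _ _ = edge_set adj); last first.
    by apply/setP => f; rewrite inE finset.subsetT andbT.
  apply; rewrite /t; [lia | | lia].
  by move=> u v x y uxv uvy; apply/asboolP/(ccw_crosses R V p p_convex).
have sk0 : 0 < Num.sqrt k%:R :> R by rewrite sqrtr_gt0 ltr0n.
apply: le_trans (_ : (t * n)%:R <= _); first by rewrite ler_nat -Vn.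
have -> : (Num.sqrt 2 + 4 / Num.sqrt k%:R) * Num.sqrt k%:R = Num.sqrt (2 * k%:R) + 4 :> R.
  by rewrite mulrDl divfK ?gt_eqF // sqrtrM.
rewrite natrM -[leLHS]addr0 lerD //; apply: ler_wpM2r => //.
rewrite /t natrD; lra.
Qed.
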